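(* Suppose that points of $\mathbb{R}^d$ arrive in a stream and are summarized by the merge-and-reduce coreset tree with node size $n$ (as defined in the context). Let $p(t)$ be the number of points received up to time $t$ and let $q(t)$ be defined by $2^{q(t)}=p(t)/n$. Then the space complexity to hold the coreset tree $2^{\cup_t C_i}$ in memory is $\mathcal{O}(n\,d\,q(t))$, where $n$ is the size of the coreset of points with dimension $d$.
   Context: Merge-and-reduce coreset tree with node size $n$. Points (row vectors) of $\mathbb{R}^d$ arrive one after another. Each block of $n$ consecutive points forms a leaf $C_i\in\mathbb{R}^{n\times d}$, which is inserted as a node of level $0$. Whenever two adjacent nodes of the same level $\ell$ are present in memory, they are merged: their $n\times d$ matrices are stacked into a $2n\times d$ matrix, this matrix is compressed to an $n\times d$ matrix (a coreset, computed via a singular value decomposition), the result is stored as a single node of level $\ell+1$, and the two merged nodes are deleted from memory. Merging is repeated recursively as long as two nodes of the same level are present. In particular, when $p(t)=n2^{q_0}$, only one node (the root) remains in memory. The depth of the tree at time $t$ is $\lfloor q(t)\rfloor$. The entire set of data up to time $t$, with leaves $C_i$, is denoted $\cup_t C_i$, and the coreset tree built from it is denoted $2^{\cup_t C_i}$. Holding the tree in memory means storing those of its nodes that have not been deleted by merging; each node is an $n\times d$ array. *)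

(* Defs.v *)
From mathcomp Require Import all_boot all_order all_algebra.
From mathcomp Require Import reals.
Set Implicit Arguments.
Unset Strict Implicit.
Unset Printing Implicit Defensive.

Record node (R : realType) (n d : nat) := Node {
  node_level : nat;
  node_data : 'M[R]_(n, d) }.

(* The nodes held in memory, most recent first. *)
Definition memory (R : realType) (n d : nat) := seq (node R n d).

(* Leaves are indexed from 0; row j of a leaf is its j-th point. *)
Definition leaf_mx (R : realType) (n d : nat) (x : nat -> 'rV[R]_d) (i : nat) :
    'M[R]_(n, d) :=
  \matrix_(j < n) x (i * n + j)%N.

(* [compress] is the map sending the 2n x d stack to its n x d coreset; nothing
   is assumed about it, so it may be any construction from a singular value
   decomposition of the stack. *)
Definition merge_nodes (R : realType) (n d : nat)
    (compress : 'M[R]_(n + n, d) -> 'M[R]_(n, d)) (older newer : node R n d) :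
    node R n d :=
  Node (node_level older).+1
       (compress (col_mx (node_data older) (node_data newer))).

(* One merge, of the most recent adjacent pair of equal level; the memory is
   unchanged if there is no such pair. *)
Fixpoint merge_step (R : realType) (n d : nat)
    (compress : 'M[R]_(n + n, d) -> 'M[R]_(n, d)) (M : memory R n d) :
    memory R n d :=
  if M is b :: M' then
    if M' is a :: M'' then
      if node_level a == node_level b then merge_nodes compress a b :: M''
      else b :: merge_step compress M'
    else M
  else M.

(* Every effective merge shortens the memory, so [size M] steps reach a memory
   without adjacent nodes of equal level. *)
Definition merge_all (R : realType) (n d : nat)
    (compress : 'M[R]_(n + n, d) -> 'M[R]_(n, d)) (M : memory R n d) :
    memory R n d :=
  iter (size M) (merge_step compress) M.

Fixpoint tree_of_leaves (R : realType) (n d : nat)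
    (compress : 'M[R]_(n + n, d) -> 'M[R]_(n, d)) (x : nat -> 'rV[R]_d)
    (k : nat) : memory R n d :=
  if k is k'.+1 then
    merge_all compress (Node 0 (leaf_mx n x k') :: tree_of_leaves compress x k')
  else [::].

(* Content of the memory after the first m points x 0, ..., x (m - 1); an
   incomplete last block is not yet a leaf. *)
Definition coreset_tree (R : realType) (n d : nat)
    (compress : 'M[R]_(n + n, d) -> 'M[R]_(n, d)) (x : nat -> 'rV[R]_d)
    (m : nat) : memory R n d :=
  tree_of_leaves compress x (m %/ n).

(* Number of real numbers stored. *)
Definition storage (R : realType) (n d : nat) (M : memory R n d) : nat :=
  (\sum_(v <- M) n * d)%N.

(* Main.v *)
Require Import Defs.
From mathcomp Require Import all_boot all_order all_algebra.
From mathcomp Require Import reals exp.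
Import Order.TTheory GRing.Theory Num.Theory.
Local Open Scope ring_scope.

(** The tree behaves like a binary counter: after k leaves the levels of the
    stored nodes are pairwise distinct and the powers 2^level add up to k (they
    are the binary digits of k).  Hence s stored nodes force
    2^s - 1 = 2^0 + ... + 2^(s-1) <= k <= p / n = 2^q, so s <= q + 1 <= 2 q as
    soon as q >= 1, and each node holds n d numbers. *)

Definition levels {R : realType} {n d : nat} (M : memory R n d) : seq nat :=
  [seq node_level v | v <- M].

Definition leaf_count (s : seq nat) : nat := (\sum_(l <- s) 2 ^ l)%N.

(** The entry of index [i] is at least [m + i], so the sum dominates a geometric one. The offset [m]
    lets the induction pass to the tail, whose entries exceed [m]. *)
Lemma expn_size_le_leaf_count (m : nat) (s : seq nat) :
  sorted ltn s -> all (leq m) s ->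
  (2 ^ (m + size s) <= 2 ^ m + leaf_count s)%N.
Proof.
rewrite /leaf_count.
elim: s m => [|a s IHs] m /=; first by rewrite addn0 leq_addr.
move=> path_as /andP[le_ma _]; rewrite big_cons addnS -addSn.
have gt_m : all (leq m.+1) s.
  apply: sub_all (order_path_min ltn_trans path_as) => b.
  exact: leq_ltn_trans.
apply: leq_trans (IHs m.+1 (path_sorted path_as) gt_m) _.
by rewrite addnA leq_add2r expnS mul2n -addnn leq_add2l leq_exp2l.
Qed.

Section Merging.

Variables (R : realType) (n d : nat).
Variable compress : 'M[R]_(n + n, d) -> 'M[R]_(n, d).
Implicit Type M : memory R n d.

Lemma merge_step_id M :
  sorted ltn (levels M) -> merge_step compress M = M.
Proof.
elim: M => [|b [|a M] IHM] //= /andP[lt_ba path_aM].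
by rewrite gtn_eqF // -[in RHS](IHM path_aM).
Qed.

(** A merge replaces two nodes of level [l] by one of level [l + 1], and [2 ^ l + 2 ^ l = 2 ^ l.+1]:
    a carry in the counter. *)
Lemma leaf_count_merge_step M :
  leaf_count (levels (merge_step compress M)) = leaf_count (levels M).
Proof.
rewrite /leaf_count; elim: M => [|b [|a M] IHM] //=.
case: eqP => [eq_ab|_]; last first.
  by rewrite [LHS]big_cons [RHS]big_cons; congr addn; apply: IHM.
by rewrite /= !big_cons addnA eq_ab addnn -mul2n -expnS.
Qed.

Lemma leaf_count_merge_all M :
  leaf_count (levels (merge_all compress M)) = leaf_count (levels M).
Proof.
rewrite /merge_all; elim: (size M) => //= k IHk.
by rewrite leaf_count_merge_step.
Qed.

(* Only the newest node can share its level with its neighbour, and this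
   persists after a merge. *)
Lemma sorted_iter_merge_step (k : nat) M :
  sorted leq (levels M) -> sorted ltn (behead (levels M)) -> (size M <= k)%N ->
  sorted ltn (levels (iter k (merge_step compress) M)).
Proof.
elim: k M => [|k IHk] M; first by case: M.
case: (boolP (sorted ltn (levels M))) => [sortedM _ _ _|].
  (* Surplus iterations are harmless: a strictly sorted memory is a fixed point. *)
  by rewrite iter_fix ?merge_step_id.
case: M => [|b [|a M]] //=; rewrite negb_and -leqNgt.
move=> nsorted /andP[le_ba _] path_aM lt_Mk.
have eq_ab : node_level a = node_level b.
  by apply/eqP; rewrite eqn_leq le_ba andbT; move: nsorted; rewrite path_aM orbF.
rewrite -iterS iterSr /= eq_ab eqxx; apply: IHk => //=.
- case: M path_aM {lt_Mk nsorted} => //= c M /andP[lt_ac path_cM].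
  (* [lt_ac] unfolds to the weak inequality between the merged level, one above that of [a], and the
     level of [c]. *)
  by apply/andP; split; [exact: lt_ac | apply: (sub_path ltnW)].
- exact: path_sorted path_aM.
Qed.

Lemma sorted_levels_tree (x : nat -> 'rV[R]_d) (k : nat) :
  sorted ltn (levels (tree_of_leaves compress x k)).
Proof.
elim: k => //= k sorted_k; apply: sorted_iter_merge_step => //=.
(* The new leaf has level 0, so only a tie at the head is possible. *)
case: (levels _) sorted_k => //= a s.
exact: (sub_path ltnW).
Qed.

Lemma leaf_count_tree (x : nat -> 'rV[R]_d) (k : nat) :
  leaf_count (levels (tree_of_leaves compress x k)) = k.
Proof.
elim: k => [|k IHk] /=; first by rewrite /leaf_count big_nil.
by rewrite leaf_count_merge_all /leaf_count /= big_cons -/(leaf_count _) IHk.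
Qed.

Lemma expn_size_tree (x : nat -> 'rV[R]_d) (k : nat) :
  (2 ^ size (tree_of_leaves compress x k) <= k.+1)%N.
Proof.
have := @expn_size_le_leaf_count 0 _ (sorted_levels_tree x k).
by rewrite leaf_count_tree size_map; apply; apply/allP.
Qed.

Lemma storageE M : storage M = (size M * (n * d))%N.
Proof. by rewrite /storage big_const_seq count_predT iter_addn_0 mulnC. Qed.

End Merging.

Theorem theorem2 (R : realType) :
  exists C q0 : R,
    forall (n d : nat) (compress : 'M[R]_(n + n, d) -> 'M[R]_(n, d))
           (x : nat -> 'rV[R]_d) (p : R -> nat) (q : R -> R),
      (0 < n)%N ->
      (forall s t : R, s <= t -> (p s <= p t)%N) ->
      (forall t : R, (0 < p t)%N -> 2 `^ q t = (p t)%:R / n%:R) ->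
      forall t : R, (0 < p t)%N -> q0 <= q t ->
        (storage (coreset_tree compress x (p t)))%:R <= C * (n%:R * d%:R * q t).
Proof.
exists 2, 1 => n d compress x p q n_gt0 _ def_q t pt_gt0 q_ge1.
rewrite storageE natrM natrM mulrC mulrCA ler_wpM2l ?mulr_ge0 ?ler0n //.
rewrite /coreset_tree; set s := size _.
have leaves_le : (p t %/ n)%:R <= 2 `^ q t :> R.
  by rewrite def_q // ler_pdivlMr ?ltr0n // -natrM ler_nat leq_trunc_div.
have q_ge0 : 0 <= q t := le_trans ler01 q_ge1.
have pow_ge1 : 1 <= 2 `^ q t :> R.
  by rewrite -[leLHS](powRr0 2) ler_powR // ler1n.
(* With [k] leaves, [2 ^ s <= k + 1 <= 2 ^ q + 2 ^ q]; [pow_ge1] absorbs the 1. *)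
have : 2 `^ s%:R <= 2 `^ (1 + q t) :> R.
  rewrite powR_mulrn // powRD; last by rewrite pnatr_eq0 implybT.
  rewrite powRr1 // -natrX mulr_natl mulr2n.
  apply: le_trans (lerD leaves_le pow_ge1).
  by rewrite natr1 ler_nat expn_size_tree.
(* Exponents are compared through [expR], cancelling [ln 2 > 0]. *)
rewrite /powR pnatr_eq0 ler_expR ler_pM2r ?ln_gt0 ?ltr1n // => /le_trans; apply.
by rewrite mulr_natl mulr2n lerD2r.
Qed.
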